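(* Let $k\ge 1$ and let $G$ be an amenable group with a finitely additive right-invariant probability measure $\mu$ (on all subsets of $G$) such that $$\int_{x_1\in G}\left(\dots\left(\int_{x_k\in G}\mathds{1}_{w_{G,k}^{-1}(1)}(x_1,\ldots,x_k)\,\mathrm{d}\mu\right)\ldots\right)\mathrm{d}\mu>0 .$$ Then $G$ has a finite index subgroup which is FC-nilpotent of class at most $k-1$. Furthermore, there exists a characteristic subgroup $N$ of $G$ which is nilpotent of class less than $k$ and such that $G/N$ is uniformly locally finite.
   Context: The left normed commutator words are $w_1=x_1$, $w_{k+1}=[w_k,x_{k+1}]$, and $w_{G,k}^{-1}(1)=\{(x_1,\ldots,x_k)\in G^k : [x_1,\ldots,x_k]=1\}$; $\mathds{1}_Y$ is the indicator function of $Y$. A group is amenable if it carries a finitely additive right-invariant probability measure $\mu$ on its power set; $\int\cdot\,\mathrm{d}\mu$ denotes the corresponding right-invariant mean on bounded real functions on $G$. For a normal subgroup $N$ of a group $G$ and $x\in G$, let $C_G(x/N)=\{g\in G:[g,x]\in N\}$ and $\mathrm{FC}_G(G/N)=\{x\in G: |G:C_G(x/N)|<\infty\}$. Put $\mathrm{FC}_0(G)=\{1\}$ and $\mathrm{FC}_{n+1}(G)=\mathrm{FC}_G(G/\mathrm{FC}_n(G))$. A group $G$ is FC-nilpotent of class (at most) $n$ if $G=\mathrm{FC}_n(G)$. A group is uniformly locally finite if for every $d\ge 1$ there is $r$ such that every subgroup generated by $d$ elements has order at most $r$. Nilpotent of class $0$ means trivial. *)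

(* Defs.v *)
From HB Require Import structures.
From mathcomp Require Import all_boot all_order all_algebra.
From mathcomp Require Import all_classical all_reals all_analysis.

Set Implicit Arguments.
Unset Strict Implicit.
Unset Printing Implicit Defensive.

Local Open Scope classical_set_scope.
Local Open Scope group_scope.
Local Open Scope quotient_scope.

(* A subset H of G is a subgroup. A subgroup is represented by its carrier
   set, and the notions below that depend on an ambient group take that
   carrier as an argument ([set: G] for the whole group). *)
Definition subgroup (G : groupType) (H : set G) : Prop :=
  H 1 /\ forall x y, H x -> H y -> H (x / y).

Definition generated (G : groupType) (A : set G) : set G :=
  smallest (@subgroup G) A.

(* |H : K| is finite: there are finitely many right cosets K g, g in H *)
Definition finite_index (G : groupType) (H K : set G) : Prop :=
  finite_set [set [set k * g | k in K] | g in H].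

Definition characteristic (G : groupType) (N : set G) : Prop :=
  subgroup N /\ forall f : {multiplicative G -> G}, bijective f -> f @` N = N.

Fixpoint lower_central (G : groupType) (H : set G) (n : nat) : set G :=
  if n is m.+1 then
    generated [set [~ x, y] | x in lower_central H m & y in H]
  else H.

(* lower_central is indexed from 0, so that class at most c means that the
   c-th term is trivial; class at most 0 means trivial *)
Definition nilpotent_class_le (G : groupType) (H : set G) (c : nat) : Prop :=
  subgroup H /\ lower_central H c = [set 1].

(* C_H(x/N) and FC_H(H/N) *)
Definition centralizer_mod (G : groupType) (H N : set G) (x : G) : set G :=
  [set g | H g /\ N [~ g, x]].

Definition FC_mod (G : groupType) (H N : set G) : set G :=
  [set x | H x /\ finite_index H (centralizer_mod H N x)].

Fixpoint FC (G : groupType) (H : set G) (n : nat) : set G :=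
  if n is m.+1 then FC_mod H (FC H m) else [set 1].

Definition FC_nilpotent (G : groupType) (H : set G) (n : nat) : Prop :=
  subgroup H /\ H = FC H n.

Definition uniformly_locally_finite (Q : groupType) : Prop :=
  forall d : nat, (1 <= d)%N -> exists r : nat,
    forall x : 'I_d -> Q, (generated (range x) #<= `I_r)%card.

Record normal_subgroup (G : groupType) := NormalSubgroup {
  nsub :> set G;
  nsub_subgroup : subgroup nsub;
  nsub_conjg : forall x y, nsub x -> nsub (x ^ y) }.

Section QuotientGroup.
Variables (G : groupType) (N : normal_subgroup G).

Fact nsub_1 : nsub N 1. Proof. by case: (nsub_subgroup N). Qed.

Fact nsub_F x y : nsub N x -> nsub N y -> nsub N (x / y).
Proof. by case: (nsub_subgroup N) => _; apply. Qed.

Fact nsub_V x : nsub N x -> nsub N x^-1.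
Proof. by move=> Nx; rewrite -[x^-1]mul1g; exact: nsub_F nsub_1 Nx. Qed.

Fact nsub_M x y : nsub N x -> nsub N y -> nsub N (x * y).
Proof. by move=> Nx Ny; rewrite -[y]invgK; apply/nsub_F/nsub_V. Qed.

Definition coset_rel (x y : G) : bool := `[< nsub N (x^-1 * y) >].

Lemma coset_rel_equiv : equiv_class_of coset_rel.
Proof.
split=> [x|x y|y x z].
- by apply/asboolP; rewrite mulVg; exact: nsub_1.
- by apply/asboolP/asboolP => /nsub_V; rewrite invgM invgK.
- move=> /asboolP xy /asboolP yz; apply/asboolP.
  by have := nsub_M xy yz; rewrite mulgA mulgK.
Qed.

Canonical coset_equiv := EquivRelPack coset_rel_equiv.
Canonical coset_equiv_direct := defaultEncModRel coset_rel.

Definition quotient_group : Type := {eq_quot coset_rel}.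

HB.instance Definition _ := Choice.on quotient_group.
HB.instance Definition _ : EqQuotient G coset_rel quotient_group :=
  EqQuotient.on quotient_group.

Local Notation Q := quotient_group.

Definition quo (x : G) : Q := \pi_Q x.

Lemma quo_eqP (x y : G) : quo x = quo y <-> nsub N (x^-1 * y).
Proof. by split=> [/eqmodP/asboolP|Nxy] //; apply/eqmodP/asboolP. Qed.

Fact quo_repr (u : Q) : quo (repr u) = u. Proof. exact: reprK. Qed.

Definition quo_mul (u v : Q) : Q := quo (repr u * repr v).
Definition quo_inv (u : Q) : Q := quo (repr u)^-1.

Fact quo_mulE x y : quo_mul (quo x) (quo y) = quo (x * y).
Proof.
have /quo_eqP Nx := quo_repr (quo x); have /quo_eqP Ny := quo_repr (quo y).
apply/quo_eqP; set a := repr _ in Nx *; set b := repr _ in Ny *.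
have := nsub_M (nsub_conjg b Nx) Ny.
by rewrite conjgE invgM !mulgA mulgK.
Qed.

Fact quo_invE x : quo_inv (quo x) = quo x^-1.
Proof.
have /quo_eqP Nx := quo_repr (quo x).
apply/quo_eqP; set a := repr _ in Nx *.
have := nsub_conjg x^-1 (nsub_V Nx).
by rewrite conjgE invgM !invgK !mulgA mulgV mul1g.
Qed.

Fact quo_mulA : associative quo_mul.
Proof.
move=> u v w; rewrite -(quo_repr u) -(quo_repr v) -(quo_repr w).
by rewrite !quo_mulE mulgA.
Qed.

Fact quo_mul1x : left_id (quo 1) quo_mul.
Proof. by move=> u; rewrite -(quo_repr u) quo_mulE mul1g. Qed.

Fact quo_mulx1 : right_id (quo 1) quo_mul.
Proof. by move=> u; rewrite -(quo_repr u) quo_mulE mulg1. Qed.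

Fact quo_mulVx : left_inverse (quo 1) quo_inv quo_mul.
Proof. by move=> u; rewrite -(quo_repr u) quo_invE quo_mulE mulVg. Qed.

Fact quo_mulxV : right_inverse (quo 1) quo_inv quo_mul.
Proof. by move=> u; rewrite -(quo_repr u) quo_invE quo_mulE mulgV. Qed.

HB.instance Definition _ := isGroup.Build quotient_group
  quo_mulA quo_mul1x quo_mulx1 quo_mulVx quo_mulxV.

Lemma quo_is_multiplicative : {morph quo : x y / x * y}.
Proof. by move=> x y; rewrite -quo_mulE. Qed.

HB.instance Definition _ :=
  isMultiplicative.Build G quotient_group quo quo_is_multiplicative.

Lemma quo_surj (u : Q) : exists x, quo x = u.
Proof. by exists (repr u); exact: quo_repr. Qed.

End QuotientGroup.

(* w_k, on nonempty tuples (x_1, ..., x_k); the value at the empty tuple is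
   immaterial *)
Definition left_normed (G : groupType) (s : seq G) : G :=
  if s is x :: s' then foldl (@commg G) x s' else 1.

(* the fibre w_{G,k}^{-1}(1) *)
Definition left_normed_fiber (G : groupType) (k : nat) : set (k.-tuple G) :=
  [set t : k.-tuple G | left_normed t = 1].

(* G with its full power set as measurable sets, so that contents on
   [discr G] are exactly the finitely additive measures defined on all
   subsets of G *)
Definition discr (G : groupType) : Type := G.

HB.instance Definition _ (G : groupType) := Choice.on (discr G).
HB.instance Definition _ (G : groupType) := isPointed.Build (discr G) (1 : G).
HB.instance Definition _ (G : groupType) :=
  @isMeasurable.Build default_measure_display (discr G)
    discrete_measurable discrete_measurable0
    discrete_measurableC discrete_measurableU.

Definition right_invariant (R : realType) (G : groupType)
    (mu : set (discr G) -> \bar R) : Prop :=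
  forall (A : set G) (g : G), mu [set a * g | a in A] = mu A.

(* The library's integral is defined for an arbitrary set function mu. For mu
   a finitely additive probability on all subsets and f bounded nonnegative,
   it is the supremum of the integrals of the simple functions below f, i.e.,
   the value at f of the mean determined by mu.
   iter_integral mu F is the iterated integral of F(x_1, ..., x_k), with x_k
   innermost and x_1 outermost. *)
Fixpoint iter_integral (R : realType) (G : groupType)
    (mu : set (discr G) -> \bar R) (k : nat) :
    (k.-tuple G -> \bar R) -> \bar R :=
  match k return (k.-tuple G -> \bar R) -> \bar R with
  | 0 => fun F => F [tuple]
  | k'.+1 => fun F =>
      (\int[mu]_(x in [set: discr G])
         iter_integral mu (fun t : k'.-tuple G => F [tuple of x :: t]))%E
  end.

(* Main.v *)
Require Import Defs.
From HB Require Import structures.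
From mathcomp Require Import all_boot all_order all_algebra.
From mathcomp Require Import all_classical all_reals all_analysis.

(** The proof replaces the series FC_i(G) by a quantitative one.  Let bFC 0 n be
trivial, and let bFC (i+1) n be the set of those x for which G has a colouring
with n colours such that [g / h, x] lies in bFC i n whenever g and h have the
same colour.  So bFC 1 n consists of elements with at most n conjugates, and
for larger i the same n bounds all layers at once, which FC_i(G) does not
provide.  Each bFC i n is closed under conjugation and inverses, and the
products of two of its elements lie in some bFC i p.  Write k = k' + 1.

From the mean to bounded elements.  Let e > 0.  If the iterated mean over
z_1, ..., z_i of the indicator of [y, z_1, ..., z_i] = 1 is at least e, then y
lies in bFC i n for an n which depends only on i and e (commg_mean_bFC).
Indeed the set B of those z for which the remaining mean at [y, z] is at least
e / 2 has measure at least e / 2; a maximal disjoint family of translates of B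
is finite, which colours G; and [y, b^-1 * c] is a product of conjugates of
[y, c] and of the inverse of [y, b].  Hence some bFC k' n has positive measure.
The same covering argument shows that the union H over all n of the bFC k' n is
a subgroup of finite index, and that it equals a single bFC k' m
(bFC_fin_index).  This H is FC-nilpotent of class at most k', because the
intersection of H with bFC i n is contained in FC_i(H).

The nilpotent subgroup.  If x is in bFC (i+1) n, the pigeonhole principle on
the powers of g shows that [x, g^(n!)] is in some bFC i p, with p independent of
x and g.  Iterating, there is d > 0 with [x, g_1^d, ..., g_k'^d] = 1 for all x
in H and all g_j (bFC_iter_cent).  Let N be the subgroup generated by all e-th
powers, where e is a multiple of d such that g^e is in H for all g.  Then N is
characteristic, [H, N, ..., N] = 1 with k' factors N, and N is contained in H,
so N is nilpotent of class at most k'.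

Uniform local finiteness of G / N.  This is a compactness argument.  If for
some d there were d-generated subgroups of G / N of unbounded order, consider
the group P of sequences in G, a nonprincipal ultrafilter on the indices, and
the normal subgroup M of the sequences that are almost everywhere in N.  The
uniform bounds in H pass to P: the series of iterated FC-centres of P over M
reaches a subgroup of finite index after k' steps (almost_bFC).  As P / M has
exponent dividing e, its finitely generated subgroups are finite
(fin_index_FC_torsion): in a finitely generated subgroup of one layer, some
subgroup of finite index centralises the whole modulo the layer below; it is
finitely generated by Schreier's lemma, and a finitely generated abelian group
of finite exponent is finite.  So the sequences of generators generate a finite
group modulo M.  Its multiplication by generators is described by finitely many
relations, which hold at almost all indices; this bounds the orders, a
contradiction. *)

Set Implicit Arguments.
Unset Strict Implicit.
Unset Printing Implicit Defensive.
Import Order.TTheory GRing.Theory Num.Theory.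
Local Open Scope classical_set_scope.
Local Open Scope group_scope.

(** * Subgroups, colourings and indices *)

Section Groups.
Variable G : groupType.
Implicit Types (A H K L N : set G) (g h t x y : G) (s : seq G).

Lemma commgFl g h x : [~ g / h, x] = ([~ g, x] / [~ h, x]) ^ h^-1.
Proof. by rewrite /commg /conjg !gnorm. Qed.

Lemma commgFr g x y : [~ g, x / y] = ([~ g, y]^-1 * [~ g, x]) ^ y^-1.
Proof. by rewrite /commg /conjg !gnorm. Qed.

Lemma commgMr g x y : [~ g, x * y] = [~ g, y] * [~ g, x] ^ y.
Proof. by rewrite /commg /conjg !gnorm. Qed.

Lemma subgroup1 H : subgroup H -> H 1. Proof. by case. Qed.

Lemma subgroupF H : subgroup H -> forall x y, H x -> H y -> H (x / y).
Proof. by case. Qed.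

Lemma subgroupV H : subgroup H -> forall x, H x -> H x^-1.
Proof. by case=> H1 HF x Hx; rewrite -[x^-1]mul1g; apply: HF. Qed.

Lemma subgroupM H : subgroup H -> forall x y, H x -> H y -> H (x * y).
Proof.
by move=> sH x y Hx Hy; rewrite -[y]invgK; apply/(subgroupF sH)/(subgroupV sH).
Qed.

Lemma subgroupX H : subgroup H -> forall x n, H x -> H (x ^+ n).
Proof.
move=> sH x n Hx; elim: n => [|n IHn]; first exact: subgroup1.
by rewrite expgS; apply: (subgroupM sH).
Qed.

Lemma subgroupI H K : subgroup H -> subgroup K -> subgroup (H `&` K).
Proof.
move=> sH sK; split; first by split; apply: subgroup1.
move=> x y [Hx Kx] [Hy Ky].
by split; [apply: (subgroupF sH)|apply: (subgroupF sK)].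
Qed.

Lemma subgroupJ H : subgroup H -> forall x y, H x -> H y -> H (x ^ y).
Proof.
move=> sH x y Hx Hy; apply: (subgroupM sH); first exact: (subgroupV sH).
exact: (subgroupM sH).
Qed.

Lemma subgroup_generated A : subgroup (generated A).
Proof.
split=> [K [sK _]|x y gx gy K KA]; first exact: subgroup1.
by case: (KA) => sK _; apply: (subgroupF sK); [apply: gx|apply: gy].
Qed.

Lemma sub_generated A : A `<=` generated A.
Proof. exact: sub_gen_smallest. Qed.

Lemma generated_sub A H : subgroup H -> A `<=` H -> generated A `<=` H.
Proof. by move=> sH AH; apply: smallest_sub. Qed.

Lemma generated_ind A (X : set G) : X 1 ->
    (forall x a, X x -> A a -> X (x * a) /\ X (x / a)) ->
  generated A `<=` X.
Proof.
move=> X1 XA g gAg.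
suff: [set g | forall x, X x -> X (x * g) /\ X (x / g)] g.
  by move=> /(_ 1 X1)[]; rewrite mul1g.
apply: generated_sub gAg; last by move=> a Aa x Xx; apply: XA.
split=> [x Xx|y z Sy Sz x Xx]; first by rewrite invg1 !mulg1.
split; first by rewrite mulgA; apply: (Sz _ _).2; apply: (Sy _ _).1.
by rewrite invgF mulgA; apply: (Sy _ _).2; apply: (Sz _ _).1.
Qed.

(** Normality relative to H, which the layers of the FC series of H satisfy; the
ambient group need not normalise N. *)
Definition normal_in H N :=
  [/\ subgroup N, N `<=` H & forall x h, N x -> H h -> N (x ^ h)].

(** For subgroups L and A this says that A meets L in a subgroup of index at most
n in L: colour an element by its right coset.  Colourings also make sense when A
is only a subset; they pass to intersections by pairing colours, and to powers
of an element by the pigeonhole principle. *)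
Definition index_le L A n := exists c : G -> nat,
  (forall g, L g -> (c g < n)%N) /\
  (forall g h, L g -> L h -> c g = c h -> A (g / h)).

Definition fin_index L A := exists n, index_le L A n.

Lemma index_leW L A L' A' m n : L' `<=` L -> A `<=` A' -> (m <= n)%N ->
  index_le L A m -> index_le L' A' n.
Proof.
move=> LL AA mn [c [cm cA]]; exists c; split=> [g L'g|g h L'g L'h cgh].
  by apply: leq_trans mn; apply/cm/LL.
by apply/AA/cA => //; apply: LL.
Qed.

Lemma fin_indexW L A L' A' : L' `<=` L -> A `<=` A' ->
  fin_index L A -> fin_index L' A'.
Proof. by move=> LL AA [n ?]; exists n; apply: index_leW LL AA (leqnn n) _. Qed.

Lemma index_leI L A B m n : index_le L A m -> index_le L B n ->
  index_le L (A `&` B) (m * n).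
Proof.
move=> [c [cm cA]] [d [dn dB]]; exists (fun g => (c g * n + d g)%N).
have dlt g : L g -> (d g < n)%N by exact: dn.
split=> [g Lg|g h Lg Lh].
  have := cm g Lg; have := dn g Lg; move: (c g) (d g) => a b bn am.
  apply: (@leq_trans (a.+1 * n)); first by rewrite mulSn addnC ltn_add2r.
  by rewrite leq_mul2r am orbT.
move=> e; have n0 : (0 < n)%N by apply: leq_ltn_trans (dlt g Lg).
have cE : c g = c h.
  have := congr1 (fun k => k %/ n)%N e.
  by rewrite !divnMDl// !divn_small ?addn0//; apply: dlt.
split; first exact: cA.
by apply: dB => //; move: e; rewrite cE => /addnI.
Qed.

(** An element g is coloured by the first t in s with g / t in A; two elements of
the same colour differ by (g / t) / (h / t), whence the passage from A to B. *)
Lemma index_le_cover L A B s :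
    (forall g, L g -> exists2 t, t \in s & A (g / t)) ->
    (forall a b, A a -> A b -> B (a / b)) ->
  index_le L B (size s).
Proof.
move=> cov AB; exists (fun g => find (fun t => `[< A (g / t) >]) s).
have hs g : L g -> has (fun t => `[< A (g / t) >]) s.
  by move=> /cov[t ts At]; apply/hasP; exists t => //; apply/asboolP.
split=> [g /hs|g h /hs gs /hs hs' e]; first by rewrite has_find.
have /asboolP Ag := nth_find 1 gs; have /asboolP Ah := nth_find 1 hs'.
move: Ah; rewrite -e => Ah; have := AB _ _ Ag Ah.
by rewrite mulgKA.
Qed.

Lemma index_le_repr L A n : index_le L A n -> exists2 s : seq G,
  (forall t, t \in s -> L t) &
  forall g, L g -> exists2 t, t \in s & A (g / t).
Proof.
move=> [c [cn cA]].
pose P i t := L t /\ c t = i.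
pose f i := if pselect (exists t, P i t) is left e then Some (projT1 (cid e))
            else None.
have fP i t : f i = Some t -> P i t.
  by rewrite /f; case: pselect => // e [<-]; exact: (projT2 (cid e)).
exists (pmap f (iota 0 n)) => [t|g Lg].
  by rewrite mem_pmap => /mapP[i _] /esym/fP[].
have : f (c g) <> None.
  by rewrite /f; case: pselect => // -[]; exists g.
case E: (f (c g)) => [t|] // _; have [Lt ct] := fP _ _ E.
exists t; last by apply: cA.
rewrite mem_pmap; apply/mapP; exists (c g) => //.
by rewrite mem_iota /= add0n; apply: cn.
Qed.

(** Finite unions of cosets are the form in which indices compose. *)
Lemma fin_index_coverP L K : subgroup K ->
  fin_index L K <-> exists s, forall g, L g -> exists2 t, t \in s & K (g / t).
Proof.
move=> sK; split=> [[n /index_le_repr[s _ cov]]|[s cov]]; first by exists s.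
by exists (size s); apply: index_le_cover cov (subgroupF sK).
Qed.

Lemma fin_index_trans L K N : subgroup K -> subgroup N ->
  fin_index L K -> fin_index K N -> fin_index L N.
Proof.
move=> sK sN /(fin_index_coverP _ sK)[s covs] /(fin_index_coverP _ sN)[t covt].
apply/(fin_index_coverP _ sN); exists [seq y * x | y <- t, x <- s] => g Lg.
have [x xs Kgx] := covs g Lg; have [y yt Ngy] := covt _ Kgx.
by exists (y * x); [apply: allpairs_f|rewrite invgM mulgA].
Qed.

Lemma finite_indexP H K : subgroup K -> finite_index H K <-> fin_index H K.
Proof.
move=> sK; split=> [/finite_seqP[cs csE]|/(fin_index_coverP _ sK)[s cov]].
  exists (size cs), (fun g => index [set k * g | k in K] cs).
  have mem g : H g -> [set k * g | k in K] \in cs.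
    move=> Hg; have: [set [set k * g | k in K] | g in H] [set k * g | k in K].
      by exists g.
    by rewrite csE.
  split=> [g /mem|g h /mem gc /mem hc /(congr1 (nth set0 cs))].
    by rewrite index_mem.
  rewrite !nth_index// => e.
  have: [set k * g | k in K] g by exists 1; [apply: subgroup1|rewrite mul1g].
  by rewrite e => -[k Kk <-]; rewrite mulgK.
pose coset t := [set k * t | k in K].
apply: (@sub_finite_set _ _ [set` map coset s]); last exact: finite_seq.
move=> _ [g Hg <-]; have [t ts Kgt] := cov g Hg.
apply/mapP; exists t => //; apply/seteqP; split=> _ [k Kk <-].
  by exists (k * (g / t)); [apply: (subgroupM sK)|rewrite mulgA mulgVK].
by exists (k / (g / t)); [apply: (subgroupF sK)|rewrite invgF -mulgA mulgVK].
Qed.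

Lemma centralizer_mod_subgroup H N x : subgroup H -> normal_in H N ->
  subgroup (centralizer_mod H N x).
Proof.
move=> sH [sN _ nN]; split; first by split; [|rewrite comm1g]; apply: subgroup1.
move=> g h [Hg Ng] [Hh Nh]; split; first exact: subgroupF.
rewrite commgFl; apply: nN; first exact: (subgroupF sN).
exact: (subgroupV sH).
Qed.

(** The index of the set of all g in G with [g, x] in N, seen from H, is that of
the centraliser of x modulo N in H. *)
Lemma FC_modP H N x : subgroup H -> normal_in H N ->
  FC_mod H N x <-> H x /\ fin_index H [set g | N [~ g, x]].
Proof.
move=> sH nN; have sC := centralizer_mod_subgroup x sH nN.
split=> -[Hx fi]; split=> //.
  by move/finite_indexP : fi => /(_ sC); apply: fin_indexW => // g [].
apply/finite_indexP => //; case: fi => n [c [cn cN]]; exists n, c; split=> //.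
by move=> g h Hg Hh e; split; [apply: (subgroupF sH)|apply: cN].
Qed.

Lemma FC_mod_normal H N : subgroup H -> normal_in H N ->
  normal_in H (FC_mod H N).
Proof.
move=> sH nNH; have [sN _ nN] := nNH; split; last 2 first.
- by move=> x [].
- move=> x h /FC_modP-/(_ sH nNH)[Hx [n [c [cn cN]]]] Hh; apply/FC_modP => //.
  have HJ := subgroupJ sH.
  split; first exact: HJ.
  exists n, (fun g => c (g ^ h^-1)); split=> [g Hg|g k Hg Hk e].
    by apply: cn; apply: HJ => //; apply: (subgroupV sH).
  rewrite /= -(conjgKV h (g / k)) -conjRg; apply: nN => //.
  rewrite conjMg conjVg; apply: cN => //; apply: HJ => //; exact: (subgroupV sH).
split.
  apply/FC_modP => //; split; first exact: subgroup1.
  exists 1%N, (fun=> 0%N); split=> // g h _ _ _ /=.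
  by rewrite commg1; apply: subgroup1.
move=> x y /FC_modP-/(_ sH nNH)[Hx [m fx]] /FC_modP-/(_ sH nNH)[Hy [n fy]].
apply/FC_modP => //; split; first exact: (subgroupF sH).
exists (m * n)%N; apply: index_leW (index_leI fx fy) => // g [/= Ngx Ngy].
rewrite commgFr; apply: nN; last exact: (subgroupV sH).
by apply: (subgroupM sN) => //; apply: (subgroupV sN).
Qed.

Lemma iter_FC_mod_normal H N c : subgroup H -> normal_in H N ->
  normal_in H (iter c (FC_mod H) N).
Proof. by move=> sH nN; elim: c => //= c; apply: FC_mod_normal. Qed.

Lemma FC_iter H c : FC H c = iter c (FC_mod H) [set 1].
Proof. by elim: c => //= c ->. Qed.

Lemma normal_in1 H : subgroup H -> normal_in H [set 1].
Proof.
move=> sH; split.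
- by split=> // x y -> ->; rewrite mulgV.
- by move=> x ->; apply: subgroup1.
- by move=> x h -> _; rewrite conj1g.
Qed.

Lemma subgroup_commg N x : normal_in setT N -> subgroup [set g | N [~ x, g]].
Proof.
move=> [sN _ nN]; split=> [|y z /= Ny Nz].
  by rewrite /= commg1; apply: subgroup1.
rewrite commgFr; apply: nN => //.
by apply: (subgroupM sN) => //; apply: (subgroupV sN).
Qed.

Definition fin_gen L := exists s, L = generated [set` s].

Lemma fin_gen_subgroup L : fin_gen L -> subgroup L.
Proof. by move=> [s ->]; apply: subgroup_generated. Qed.

(** Schreier's lemma.  With r a set of coset representatives of K in L and S the
generators and their inverses, the elements t * a / y with t in r or t = 1, a in
S and y in r that lie in K, together with the representatives that lie in K,
generate the intersection of L and K. *)
Lemma fin_genI L K : fin_gen L -> subgroup K -> fin_index L K ->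
  fin_gen (L `&` K).
Proof.
move=> [s Ls] sK [n /index_le_repr[r rL cov]].
have sL : subgroup L by rewrite Ls; apply: subgroup_generated.
pose S := s ++ [seq x^-1 | x <- s].
pose u := [seq x / y | x <- [seq x * a | x <- 1 :: r, a <- S], y <- r] ++ 1 :: r.
pose v := [seq x <- u | `[< (L `&` K) x >]].
have vLK : generated [set` v] `<=` L `&` K.
  apply: generated_sub; first exact: subgroupI.
  by move=> x /=; rewrite mem_filter => /andP[/asboolP].
have SL a : a \in S -> L a.
  rewrite mem_cat => /orP[as_|/mapP[b bs ->]].
    by rewrite Ls; apply: sub_generated.
  by apply: (subgroupV sL); rewrite Ls; apply: sub_generated.
have sv := subgroup_generated [set` v].
(* the products of an element generated by v and a representative; this set is
   stable under right multiplication by S, hence contains L *)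
pose X := [set g | exists k t,
  [/\ generated [set` v] k, t \in 1 :: r & g = k * t]].
have XS g a : X g -> a \in S -> X (g * a).
  move=> [k [t [gk tr ->]]] aS.
  have Lt : L t.
    by move: tr; rewrite inE => /orP[/eqP->|/rL//]; apply: subgroup1.
  have Lta : L (t * a) by apply: (subgroupM sL) => //; apply: SL.
  have [y yr Ky] := cov _ Lta.
  exists (k * (t * a / y)), y; split; last by rewrite -!mulgA mulVg mulg1.
    apply: (subgroupM sv) => //; apply: sub_generated => /=.
    rewrite mem_filter; apply/andP; split.
      by apply/asboolP; split=> //; apply: (subgroupF sL) => //; apply: rL.
    rewrite mem_cat; apply/orP; left; apply: allpairs_f => //.
    exact: allpairs_f.
  by rewrite inE yr orbT.
have LX : L `<=` X.
  rewrite [X in X `<=` _]Ls; apply: generated_ind.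
    by exists 1, 1; split; [apply: subgroup1|rewrite inE eqxx|rewrite mulg1].
  move=> x a Xx /= as_; split; apply: XS => //; rewrite mem_cat ?as_//.
  by rewrite map_f ?orbT.
exists v; apply/seteqP; split=> // g [Lg Kg].
have [k [t [gk tr gE]]] := LX g Lg.
rewrite gE; apply: (subgroupM sv) => //; apply: sub_generated => /=.
have [Lk Kk] := vLK _ gk.
rewrite mem_filter; apply/andP; split.
  by apply/asboolP; rewrite -(mulKg k t) -gE; split;
    [apply: (subgroupM sL) => //; apply: (subgroupV sL)
    |apply: (subgroupM sK) => //; apply: (subgroupV sK)].
by rewrite mem_cat tr orbT.
Qed.

(** Modulo E, every element of L is a product of powers a^i with i < e, one for
each generator a, taken in a fixed order. *)
Lemma fin_index_abelian L E e : fin_gen L -> normal_in setT E -> (0 < e)%N ->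
    (forall x y, L x -> L y -> E [~ x, y]) ->
    (forall x, L x -> E (x ^+ e)) ->
  fin_index L E.
Proof.
move=> [s Ls] [sE _ nE] e0 com tor; apply/fin_index_coverP => //.
have sL : subgroup L by rewrite Ls; apply: subgroup_generated.
have sLs x : x \in s -> L x by move=> xs; rewrite Ls; apply: sub_generated.
pose T r := foldr (fun a l => [seq a ^+ i * t | i <- iota 0 e, t <- l]) [:: 1] r.
exists (T s).
pose eqv x y := E (x / y).
have eqvtrans y x z : eqv x y -> eqv y z -> eqv x z.
  by move=> xy yz; have := subgroupM sE xy yz; rewrite mulgA mulgVK.
have eqvMl z x y : eqv x y -> eqv (z * x) (z * y).
  move=> xy; rewrite /eqv; have := nE _ z^-1 xy I.
  by rewrite /conjg !gnorm.
have eqvMr z x y : eqv x y -> eqv (x * z) (y * z) by rewrite /eqv mulgKA.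
have TL r t : {subset r <= s} -> t \in T r -> L t.
  elim: r t => [|a r IHr] t rs /=.
    by rewrite inE => /eqP->; apply: subgroup1.
  move=> /allpairsP[[i t'] [_ /= t'r ->]]; apply: (subgroupM sL).
    by apply: (subgroupX sL); apply/sLs/rs; rewrite inE eqxx.
  by apply: IHr => // x xr; apply: rs; rewrite inE xr orbT.
have step r : {subset r <= s} -> forall a t, a \in r -> t \in T r ->
    exists2 t', t' \in T r & eqv (t * a) t'.
  elim: r => // b r IHr rs a t.
  have {}rs' : {subset r <= s} by move=> x xr; apply: rs; rewrite inE xr orbT.
  have Lb : L b by apply/sLs/rs; rewrite inE eqxx.
  rewrite inE => /orP[/eqP->|ar] /allpairsP[[i t'] [/= ie t'r ->]]; last first.
    have [t2 t2r t2E] := IHr rs' _ _ ar t'r.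
    exists (b ^+ i * t2); first exact: allpairs_f.
    by rewrite -mulgA; apply: eqvMl.
  have Lt' := TL _ _ rs' t'r.
  have swap : eqv (b ^+ i * t' * b) (b ^+ i.+1 * t').
    rewrite expgSr -!mulgA; apply: eqvMl.
    have := com _ _ (subgroupV sL Lt') (subgroupV sL Lb).
    by rewrite /eqv /commg /conjg !gnorm.
  move: ie; rewrite mem_iota add0n /= leq_eqVlt => /orP[/eqP ie|ie].
    exists (b ^+ 0 * t'); first by apply: allpairs_f => //; rewrite mem_iota.
    apply: eqvtrans swap _; rewrite ie mul1g.
    by have := tor b Lb; rewrite /eqv mulgK.
  by exists (b ^+ i.+1 * t') => //; apply: allpairs_f => //; rewrite mem_iota.
suff : L `<=` [set g | exists2 t, t \in T s & eqv g t] by [].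
rewrite [X in X `<=` _]Ls.
(* inverses of generators are dealt with as powers a ^+ e.-1 *)
have stepX a t i : a \in s -> t \in T s ->
    exists2 t', t' \in T s & eqv (t * a ^+ i) t'.
  move=> as_ ts; elim: i => [|i [t' t's IHi]].
    by exists t => //; rewrite mulg1 /eqv mulgV; apply: subgroup1.
  have [t2 t2s t2E] := step s (fun=> id) _ _ as_ t's.
  exists t2 => //; rewrite expgSr mulgA.
  by apply: eqvtrans t2E; apply: eqvMr.
apply: generated_ind.
  exists 1; last by rewrite /eqv mulgV; apply: subgroup1.
  elim: (s) => [|a r IHr] /=; first by rewrite inE.
  by rewrite -[1](mulg1 (a ^+ 0)); apply: allpairs_f => //; rewrite mem_iota.
move=> x a [t ts xt] /= as_; split.
  have [t' t's tE] := stepX a t 1%N as_ ts.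
  by exists t' => //; apply: eqvtrans tE; apply: eqvMr.
have [t' t's tE] := stepX a t e.-1 as_ ts.
exists t' => //; apply: (eqvtrans _ _ _ _ tE); apply: eqvtrans (eqvMr _ _ _ xt) _.
apply: eqvMl; rewrite /eqv -invgM -expgSr prednK//.
by apply: (subgroupV sE); apply: tor; apply: sLs.
Qed.

(** Going down the series E_c = iter c (FC_mod setT) M, the finitely generated
group L1, the intersection of L and E_(c+1), has a subgroup K of finite index
that commutes with the generators of L1 modulo E_c.  As K is contained in L1, it
is abelian modulo E_c, so that E_c has finite index in K, thus in L. *)
Lemma fin_index_FC_torsion M e c L : normal_in setT M -> (0 < e)%N ->
    (forall x, M (x ^+ e)) -> fin_gen L ->
    fin_index L (iter c (FC_mod setT) M) ->
  fin_index L M.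
Proof.
move=> nM e0 tor; elim: c L => [//|c IHc] L fgL fiL.
pose E i := iter i (FC_mod setT) M.
have nE i : normal_in setT (E i) by apply: iter_FC_mod_normal.
have sE i : subgroup (E i) by case: (nE i).
have ME i x : M x -> E i x.
  elim: i => // i IHi /IHi Mx; apply/FC_modP => //; split=> //.
  exists 1%N, (fun=> 0%N); split=> // g h _ _ _ /=.
  rewrite commgEr; apply: (subgroupM (sE i)) => //.
  by case: (nE i) => _ _; apply => //; apply: (subgroupV (sE i)).
have fgL1 : fin_gen (L `&` E c.+1) by apply: fin_genI.
have sL1 := fin_gen_subgroup fgL1.
apply: (@fin_index_trans _ (L `&` E c.+1)) => //; first by case: nM.
  case: fiL => n [d [dn dE]]; exists n, d; split=> // g h Lg Lh gh; split.
    exact: (subgroupF (fin_gen_subgroup fgL)).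
  exact: dE.
apply: IHc => //.
move: fgL1 sL1; set L1 := L `&` _ => fgL1 sL1.
have [s L1s] := fgL1.
have [K [sK KL1 fiK comK]] : exists K, [/\ subgroup K, K `<=` L1, fin_index L1 K
    & forall g x, K g -> x \in s -> E c [~ g, x]].
  have : {subset s <= [pred x | `[< L1 x >]]}.
    by move=> x xs; apply/asboolP; rewrite L1s; apply: sub_generated.
  elim: (s) => [|a r IHr] rs.
    exists L1; split=> //; exists 1%N, (fun=> 0%N); split=> // g h *.
    exact: (subgroupF sL1).
  have [|K [sK KL1 [m fiK] comK]] := IHr.
    by move=> x xr; apply: rs; rewrite inE xr orbT.
  have /asboolP[_ /FC_modP[//|//|_ [n fia]]] : a \in [pred x | `[< L1 x >]].
    by apply: rs; rewrite inE eqxx.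
  exists (K `&` centralizer_mod setT (E c) a); split.
  - by apply: subgroupI => //; apply: centralizer_mod_subgroup.
  - by move=> x [/KL1].
  - exists (m * n)%N; have := index_leW (@subsetT _ L1) (@subset_refl _ _) (leqnn n) fia.
    move=> /(index_leI fiK); apply: index_leW => //.
    by move=> x [Kx Ex]; split.
  - move=> g x [Kg [_ Eg]]; rewrite inE => /orP[/eqP->//|xr].
    exact: comK.
have fgK : fin_gen K.
  have -> : K = L1 `&` K by apply/esym/setIidr.
  exact: fin_genI.
apply: (@fin_index_trans _ K) => //; first exact: sE.
apply: (fin_index_abelian fgK (nE c) e0) => [x y Kx /KL1|x Kx]; last exact: ME.
suff: L1 `<=` [set y | E c [~ x, y]] by exact.
rewrite [X in X `<=` _]L1s; apply: generated_sub => [|a /= as_]; last exact: comK.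
exact: subgroup_commg.
Qed.

End Groups.

(** * Elements of bounded FC type and power subgroups *)

Section Bounded.
Variable G : groupType.
Implicit Types (A H K L N : set G) (g h t x y : G) (s : seq G).

(** A uniform version of the FC series, with one bound n for all layers.  The
union over n of bFC i n is contained in FC_i(G), but can be smaller. *)
Fixpoint bFC (i n : nat) : set G :=
  if i is j.+1 then [set x | index_le setT [set g | bFC j n [~ g, x]] n]
  else [set 1].

Lemma bFC_mono i m n : (m <= n)%N -> bFC i m `<=` bFC i n.
Proof.
move=> mn; elim: i => //= i IHi x; apply: index_leW => // g.
exact: IHi.
Qed.

Lemma bFC1 i n : bFC i n.+1 1.
Proof.
elim: i => // i IHi; exists (fun=> 0%N); split=> // g h _ _ _ /=.
by rewrite commg1.
Qed.

Lemma bFCJ i n x g : bFC i n x -> bFC i n (x ^ g).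
Proof.
elim: i x => [x ->|i IHi x]; first by rewrite /= conj1g.
move=> [c [cn cF]]; exists (fun h => c (h ^ g^-1)); split=> [h _|h k _ _ e].
  exact: cn.
rewrite /= -(conjgKV g (h / k)) -conjRg; apply: IHi.
by rewrite conjMg conjVg; apply: cF.
Qed.

Lemma bFCV i n x : bFC i n x -> bFC i n x^-1.
Proof.
elim: i x => [x ->|i IHi x]; first by rewrite /= invg1.
apply: index_leW => // g /= /IHi; rewrite invgR => /(@bFCJ _ _ _ x^-1).
rewrite conjRg; suff -> : [~ x ^ x^-1, g ^ x^-1] = [~ g, x^-1] by [].
by rewrite /commg /conjg !gnorm.
Qed.

Lemma bFC_commgC i n x y : bFC i n [~ x, y] -> bFC i n [~ y, x].
Proof. by move=> /bFCV; rewrite invgR. Qed.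

Lemma bFCM i n : exists p, forall x y, bFC i n x -> bFC i n y -> bFC i p (x * y).
Proof.
elim: i n => [n|i IHi n]; first by exists 0%N => x y -> ->; rewrite /= mulg1.
have [p pP] := IHi n; exists (maxn (n * n) p) => x y fx fy.
have := index_leI fx fy; apply: index_leW => //; last exact: leq_maxl.
move=> g [/= gx gy]; rewrite commgMr; apply: (bFC_mono (leq_maxr _ _)).
by apply: pP => //; apply: bFCJ.
Qed.

(** By [x, g^(j+1)] = [x, g^j] * [x, g] ^ g^j, only boundedly many conjugates of
[x, g] are multiplied, so p does not depend on x and g. *)
Lemma bFC_commgX i n q : exists p, forall x g, bFC i n [~ x, g] ->
  forall j, (j <= q)%N -> bFC i p [~ x, g ^+ j].
Proof.
elim: q => [|q [p pP]].
  by exists 1%N => x g _ [|//] _; rewrite commg1; apply: bFC1.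
have [r rP] := bFCM i (maxn n p).
exists (maxn p r) => x g xg j; rewrite leq_eqVlt => /orP[/eqP->|jq]; last first.
  by apply: (bFC_mono (leq_maxl _ _)); apply: pP.
rewrite expgS commgMr; apply: (bFC_mono (leq_maxr _ _)); apply: rP.
  by apply: (bFC_mono (leq_maxr _ _)); apply: pP.
by apply: (bFC_mono (leq_maxl _ _)); apply: bFCJ.
Qed.

Lemma index_le_expg A n g : index_le setT A n ->
  exists2 j, (0 < j <= n)%N & A (g ^+ j).
Proof.
move=> [c [cn cA]]; pose s := [seq c (g ^+ j) | j <- iota 0 n.+1].
have /(uniqPn 0%N)[i [j [ij]]] : ~~ uniq s.
  apply/negP => us; have : {subset s <= iota 0 n}.
    by move=> _ /mapP[j _ ->]; rewrite mem_iota /=; apply: cn.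
  by move/(uniq_leq_size us); rewrite size_map !size_iota ltnn.
rewrite size_map size_iota => jn.
have nthE l : (l < n.+1)%N -> nth 0%N s l = c (g ^+ l).
  by move=> ln; rewrite (nth_map 0%N) ?size_iota// nth_iota.
rewrite !nthE ?(ltn_trans ij)// => e; exists (j - i)%N.
  by rewrite subn_gt0 ij (leq_trans (leq_subr _ _)).
by rewrite expgnFr 1?ltnW//; apply: cA.
Qed.

(** The elements x with [x, y_1, ..., y_i] = 1 for all y_1, ..., y_i in N: the
upper central series of N, except that x ranges over all of G. *)
Fixpoint iter_cent N (i : nat) : set G :=
  if i is j.+1 then [set x | forall y, N y -> iter_cent N j [~ x, y]] else [set 1].

Lemma iter_cent_normal N i : normal_in setT N -> normal_in setT (iter_cent N i).
Proof.
move=> [sN _ nN]; elim: i => [|i [sK _ nK]]; first exact: normal_in1.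
split=> //=; last first.
  move=> x h Kx _ y Ny; rewrite -(conjgKV h y) -conjRg; apply: nK => //.
  by apply: Kx; apply: nN.
split=> [y Ny|x y Kx Ky z Nz]; first by rewrite comm1g; apply: subgroup1.
rewrite commgFl; apply: nK => //.
by apply: (subgroupF sK); [apply: Kx|apply: Ky].
Qed.

Lemma iter_cent_anti M N i : N `<=` M -> iter_cent M i `<=` iter_cent N i.
Proof. by move=> NM; elim: i => //= i IHi x Kx y /NM /Kx /IHi. Qed.

(** The verbal subgroup G^e. *)
Definition power_subgroup e : set G := generated [set g ^+ e | g in setT].

Lemma power_subgroup_min e H : subgroup H -> (forall g, H (g ^+ e)) ->
  power_subgroup e `<=` H.
Proof. by move=> sH He; apply: generated_sub => // _ [g _ <-]. Qed.

Lemma power_subgroup_expg e g : power_subgroup e (g ^+ e).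
Proof. by apply: sub_generated; exists g. Qed.

Lemma power_subgroup_dvd d e : power_subgroup (d * e) `<=` power_subgroup d.
Proof.
apply: power_subgroup_min; first exact: subgroup_generated.
by move=> g; rewrite mulnC expgnA; apply: power_subgroup_expg.
Qed.

Lemma power_subgroup_normal e : normal_in setT (power_subgroup e).
Proof.
have sP : subgroup (power_subgroup e) by apply: subgroup_generated.
split=> // x h + _.
suff : power_subgroup e `<=` [set x | power_subgroup e (x ^ h)] by exact.
apply: power_subgroup_min => [|g /=].
  split=> [|y z /= Py Pz]; first by rewrite /= conj1g; apply: subgroup1.
  by rewrite conjMg conjVg; apply: (subgroupF sP).
by rewrite conjXg; apply: power_subgroup_expg.
Qed.

Lemma power_subgroup_characteristic e : characteristic (power_subgroup e).
Proof.
have sP : subgroup (power_subgroup e) by apply: subgroup_generated.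
split=> // f [f' fK f'K].
have f1 : f 1 = 1 by apply: (mulgI (f 1)); rewrite -gmulfM !mulg1.
have fX g n : f (g ^+ n) = f g ^+ n.
  by elim: n => // n IHn; rewrite !expgS gmulfM IHn.
have fF x y : f (x / y) = f x / f y.
  by apply: (mulIg (f y)); rewrite -gmulfM !mulgVK.
apply/seteqP; split.
  suff Pf : power_subgroup e `<=` [set x | power_subgroup e (f x)].
    by move=> _ [x /Pf ? <-].
  apply: power_subgroup_min => [|g /=]; last by rewrite fX; apply: power_subgroup_expg.
  split=> [|y z /= Py Pz]; first by rewrite /= f1; apply: subgroup1.
  by rewrite fF; apply: (subgroupF sP).
apply: power_subgroup_min => [|g].
  split=> [|_ _ [x Px <-] [y Py <-]].
    by exists 1; [apply: subgroup1|rewrite f1].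
  by exists (x / y); [apply: (subgroupF sP)|rewrite fF].
by exists (f' g ^+ e); [apply: power_subgroup_expg|rewrite fX f'K].
Qed.

(** The exponent for layer i + 1 must be a multiple of the one for layer i, which
depends on the bound p at layer i.  There is no circularity: p comes from the
pigeonhole principle applied to powers of g ^+ d instead of g, and is the same
for all d. *)
Lemma bFC_iter_cent i n :
  exists2 e, (0 < e)%N & bFC i n `<=` iter_cent (power_subgroup e) i.
Proof.
elim: i n => [n|i IHi n]; first by exists 1%N.
have [p pP] := bFC_commgX i n n`!.
have [d d0 dP] := IHi p; exists (d * n`!)%N.
  by rewrite muln_gt0 d0 fact_gt0.
move=> x fx /=.
set N := power_subgroup _.
suff : N `<=` [set y | iter_cent N i [~ x, y]] by [].
apply: power_subgroup_min => [|g /=].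
  exact/subgroup_commg/iter_cent_normal/power_subgroup_normal.
apply: (iter_cent_anti (@power_subgroup_dvd _ _)); apply: dP; rewrite expgnA.
have [j /andP[j0 jn] /= fj] := index_le_expg (g ^+ d) fx.
have /dvdnP[q qE] : (j %| n`!)%N by rewrite dvdn_fact// j0.
rewrite qE mulnC expgnA; apply: pP; first exact: bFC_commgC.
by rewrite qE leq_pmulr.
Qed.

(** The lower central series of N descends through the iter_cent N j. *)
Lemma nilpotent_iter_cent N c : normal_in setT N -> N `<=` iter_cent N c ->
  nilpotent_class_le N c.
Proof.
move=> nN NK; have [sN _ _] := nN; split=> //.
have lc i : (i <= c)%N -> lower_central N i `<=` iter_cent N (c - i).
  elim: i => [_|i IHi ic]; first by rewrite subn0.
  apply: generated_sub; first by case: (iter_cent_normal (c - i.+1) nN).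
  move=> _ [x /(IHi (ltnW ic)) Kx [y Ny <-]].
  by move: Kx; rewrite -(subnSK ic) => /(_ _ Ny).
apply/seteqP; split; first by have := lc c (leqnn c); rewrite subnn.
move=> _ ->; case: c {NK lc} => [|i]; first exact: subgroup1.
apply: subgroup1; exact: subgroup_generated.
Qed.

Lemma bFC_sub_FC H i n : subgroup H -> H `&` bFC i n `<=` FC H i.
Proof.
move=> sH; rewrite FC_iter; elim: i => [|i IHi] x [Hx fx] //.
apply/FC_modP => //; first exact/iter_FC_mod_normal/normal_in1.
split=> //.
case: fx => c [cn cF]; exists n, c; split=> [g Hg|g h Hg Hh e]; first exact: cn.
apply: IHi; split; last exact: cF.
have Hgh := subgroupF sH Hg Hh.
by apply: (subgroupM sH); [apply: (subgroupV sH)|apply: (subgroupJ sH)].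
Qed.

End Bounded.

(** * Integrals against a finitely additive mean *)

Section Mean.
Variables (R : realType) (G : groupType).
Variable mu : {content set (discr G) -> \bar R}%R.
Hypothesis mu_prob : mu [set: discr G] = 1%E.
Import HBNNSimple.

Lemma content_le (A B : set (discr G)) : A `<=` B -> (mu A <= mu B)%E.
Proof. by move=> AB; apply: le_measure => //; rewrite inE. Qed.

Lemma content_le1 (A : set (discr G)) : (mu A <= 1)%E.
Proof. by rewrite -mu_prob; apply: content_le. Qed.

(** Simple functions have finitely many fibres; so estimating their integrals only
needs finite additivity. *)
Lemma content_fibers (h : {nnsfun discr G >-> R}) (A : set (discr G)) :
  mu A = (\sum_(r \in range h) mu (A `&` h @^-1` [set r]))%E.
Proof.
rewrite -measure_fin_bigcup//.
- congr (mu _); apply/seteqP; split=> [x Ax|x [r _ []//]].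
  by exists (h x).
- apply/trivIsetP => r s _ _ /eqP rs.
  by apply/seteqP; split=> // x [[_ /= hr] [_ /= hs]]; apply: rs; rewrite -hr.
Qed.

(** A Markov inequality in additive form: h is at most 1 where e <= h, and at
most e elsewhere. *)
Lemma sintegral_split (h : {nnsfun discr G >-> R}) (e : R) :
    (0 <= e)%R -> (forall x, h x <= 1)%R ->
  (sintegral mu h <= mu [set x | (e <= h x)%R] + e%:E * mu [set x | (h x < e)%R])%E.
Proof.
move=> e0 h1.
have -> : sintegral mu h = (\sum_(r \in range h) r%:E * mu (h @^-1` [set r]))%E.
  rewrite /sintegral (fsbig_widen (range h) setT)//= => r [_ Nr] /=.
  by rewrite preimage10// measure0 mule0.
rewrite [mu [set x | (e <= _)%R]](content_fibers h).
rewrite [mu [set x | (_ < e)%R]](content_fibers h).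
rewrite ge0_mule_fsumr//.
rewrite -fsbig_split//=.
apply: lee_fsum => //= r [x _ <-].
have [ehx|hxe] := leP e (h x).
  apply: (@le_trans _ _ (mu (h @^-1` [set h x]))).
    by rewrite -[leRHS]mul1e lee_wpmul2r// lee_fin.
  rewrite -[leLHS]adde0 leeD ?mule_ge0//.
  by apply: content_le => y /= hy; split=> //=; rewrite hy.
rewrite -[leLHS]add0e leeD//.
apply: (@le_trans _ _ (e%:E * mu (h @^-1` [set h x]))%E).
  by rewrite lee_wpmul2r// lee_fin ltW.
rewrite lee_wpmul2l ?lee_fin//.
by apply: content_le => y /= hy; split=> //=; rewrite hy.
Qed.

Lemma sintegral_eq0 (h : discr G -> R) : h =1 cst 0%R -> sintegral mu h = 0%E.
Proof.
move=> h0; rewrite /sintegral fsbig1// => r _.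
have [->|r0] := eqVneq r 0%R; first by rewrite mul0e.
rewrite preimage10 ?measure0 ?mule0// => -[x _ /= e].
by move: r0; rewrite -e h0 eqxx.
Qed.

Lemma integral_supE (f : discr G -> \bar R) : (forall x, 0 <= f x)%E ->
  (\int[mu]_x f x = ereal_sup [set sintegral mu h |
    h in [set h : {nnsfun discr G >-> R} | forall x, (h x)%:E <= f x]])%E.
Proof.
move=> f0; rewrite /integral.
have -> : (f \_ setT)^\+%E = f.
  by apply/funext => x; rewrite funeposE patch_setT; apply/max_idPl.
have -> : (f \_ setT)^\-%E = cst 0%E.
  apply/funext => x; rewrite funenegE patch_setT; apply/max_idPr.
  by rewrite leeNl oppe0.
set I0 := (X in (_ - X)%E); suff -> : I0 = 0%E by rewrite sube0.
apply/eqP; rewrite eq_le; apply/andP; split.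
  apply: ge_ereal_sup => _ [h /= h0 <-]; rewrite sintegral_eq0// => x.
  by apply/eqP; rewrite eq_le -lee_fin h0 /=.
by apply: ereal_sup_ubound; exists nnsfun0 => //; rewrite sintegral_eq0.
Qed.

Lemma integral_le_sup (f : discr G -> \bar R) (M : \bar R) :
    (forall x, 0 <= f x)%E ->
    (forall h : {nnsfun discr G >-> R}, (forall x, (h x)%:E <= f x)%E ->
      (sintegral mu h <= M)%E) ->
  (\int[mu]_x f x <= M)%E.
Proof.
move=> f0 fM; rewrite integral_supE//.
by apply: ge_ereal_sup => _ [h /= hf <-]; exact: fM.
Qed.

Lemma integral01 (f : discr G -> \bar R) : (forall x, 0 <= f x <= 1)%E ->
  (0 <= \int[mu]_x f x <= 1)%E.
Proof.
move=> f01; have f0 x : (0 <= f x)%E by case/andP: (f01 x).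
apply/andP; split.
  rewrite integral_supE//; apply: ereal_sup_ubound.
  by exists nnsfun0 => //; rewrite sintegral_eq0.
apply: integral_le_sup => // h hf.
have h1 x : (h x <= 1)%R.
  by rewrite -lee_fin (le_trans (hf x))//; case/andP: (f01 x).
apply: le_trans (sintegral_split ler01 h1) _; rewrite mul1e -measureU//.
  exact: content_le1.
by apply/seteqP; split=> // x [/= hx]; rewrite ltNge hx.
Qed.

Lemma integral_split (f : discr G -> \bar R) (e : R) :
    (0 <= e)%R -> (forall x, 0 <= f x <= 1)%E ->
  (\int[mu]_x f x <= mu [set x | (e%:E <= f x)%E] + e%:E)%E.
Proof.
move=> e0 f01; apply: integral_le_sup => [x|h hf]; first by case/andP: (f01 x).
have h1 x : (h x <= 1)%R.
  by rewrite -lee_fin (le_trans (hf x))//; case/andP: (f01 x).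
apply: le_trans (sintegral_split e0 h1) _; apply: leeD.
  by apply: content_le => x /= ehx; apply: le_trans (hf x); rewrite lee_fin.
by rewrite -[leRHS]mule1 lee_wpmul2l ?lee_fin// content_le1.
Qed.

Lemma integral_ge (f : discr G -> \bar R) (e : R) : (0 <= e)%R ->
    (forall x, 0 <= f x <= 1)%E -> (e%:E <= \int[mu]_x f x)%E ->
  ((e / 2)%:E <= mu [set x | ((e / 2)%:E <= f x)%E])%E.
Proof.
move=> e0 f01 ef.
have e20 : (0 <= e / 2)%R by rewrite divr_ge0.
have := le_trans ef (integral_split e20 f01).
by rewrite -leeBlDr// -EFinB {1}[e]splitr addrK.
Qed.

Hypothesis mu_inv : right_invariant mu.

(** As long as some translate of B is disjoint from the translates by the elements
of s, it can be added to s, and the measure of the union grows by d.  This must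
stop before n steps since n * d > 1, and then each translate of B meets one of
those by the elements of s. *)
Lemma content_cover (B : set G) (d : R) (n : nat) : (d%:E <= mu B)%E ->
    (1 < d *+ n)%R ->
  exists2 s : seq G, (size s <= n)%N &
    forall g, exists2 t, t \in s & exists b c, [/\ B b, B c & g / t = b^-1 * c].
Proof.
move=> dB dn; pose U (s : seq G) :=
  [set g | exists2 t, t \in s & exists2 b, B b & g = b * t].
suff [//|[s sn sU]] : (exists2 s : seq G, (size s <= n)%N &
    forall g, exists2 t, t \in s & exists b c, [/\ B b, B c & g / t = b^-1 * c]) \/
    exists2 s : seq G, size s = n & ((d *+ n)%:E <= mu (U s))%E.
  by have := le_trans sU (content_le1 (U s)); rewrite lee_fin leNgt dn.
elim: (n) => [|m [[s sm cov]|[s sm sU]]].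
+ by right; exists [::] => //; rewrite mulr0n.
+ by left; exists s => //; apply: leqW.
have [[g gs]|cov] := pselect (exists g, forall t, t \in s ->
    forall b c, B b -> B c -> b * g <> c * t).
  right; exists (g :: s); first by rewrite /= sm.
  have -> : U (g :: s) = [set b * g | b in B] `|` U s.
    apply/seteqP; split=> x.
      move=> [t]; rewrite inE => /orP[/eqP->|ts] [b Bb xE].
        by left; exists b.
      by right; exists t => //; exists b.
    move=> [[b Bb <-]|[t ts [b Bb xE]]].
      by exists g; [rewrite inE eqxx|exists b].
    by exists t; [rewrite inE ts orbT|exists b].
  rewrite measureU//; last first.
    apply/seteqP; split=> // x [[b Bb <-] [t ts [c Bc]]].
    exact: gs.
  by rewrite mulrS EFinD leeD// mu_inv.
left; exists s; first by rewrite sm.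
move=> g; apply: contrapT => ng; apply: cov; exists g => t ts b c Bb Bc e.
apply: ng; exists t => //; exists b, c; split=> //.
by apply: (mulIg t); rewrite mulgVK -mulgA -e mulKg.
Qed.

End Mean.

Lemma mulrn_gt1 (R : realType) (d : R) : (0 < d)%R -> exists m, (1 < d *+ m)%R.
Proof.
move=> d0; exists (Num.bound d^-1).
have := archi_boundP (ltW (_ : 0 < d^-1)%R); rewrite invr_gt0 => /(_ d0).
move=> dm; rewrite -mulr_natr -ltr_pdivrMl//.
by rewrite mulr1.
Qed.

Section Iter.
Variables (R : realType) (G : groupType).
Variable mu : {content set (discr G) -> \bar R}%R.
Hypothesis mu_prob : mu [set: discr G] = 1%E.
Hypothesis mu_inv : right_invariant mu.

(** The iterated mean of the indicator of [y, z_1, ..., z_i] = 1 in z_1, ..., z_i,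
z_i innermost. *)
Fixpoint commg_mean (i : nat) (y : G) : \bar R :=
  if i is j.+1 then (\int[mu]_(x in [set: discr G]) commg_mean j [~ y, (x : G)]%g)%E
  else (\1_[set 1%g] y)%:E.

Lemma commg_mean01 i y : (0 <= commg_mean i y <= 1)%E.
Proof.
elim: i y => [|i IHi] y /=.
  by rewrite !lee_fin indicE; case: (_ \in _); rewrite /= ?lexx ?ler01.
exact: integral01.
Qed.

Lemma iter_integral_commg_mean i y :
  iter_integral mu (fun t : i.-tuple G =>
    (\1_[set t : i.-tuple G | foldl (@commg G) y t = 1%g] t)%:E) = commg_mean i y.
Proof.
elim: i y => [|i IHi] y //=; congr integral; apply/funext => x.
by rewrite -IHi.
Qed.

(** Let B be the set of those z for which the mean at [y, z] is at least e / 2.  It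
has measure at least e / 2 by integral_ge, so content_cover colours G with a
number of colours that depends only on e.  For g and h of the same colour,
[g / h, y] is a product of boundedly many conjugates of [y, b] and their
inverses, with b in B; these are in one bFC i n by induction, with n independent
of y. *)
Lemma commg_mean_bFC i (e : R) : (0 < e)%R ->
  exists n, forall y, (e%:E <= commg_mean i y)%E -> bFC i n y.
Proof.
elim: i e => [|i IHi] e e0.
  exists 0%N => y /=; rewrite lee_fin indicE.
  have [|_] := boolP (y \in _); first by rewrite in_setE.
  by rewrite leNgt e0.
have e20 : (0 < e / 2)%R by rewrite divr_gt0.
have [n nP] := IHi _ e20; have [p pP] := bFCM G i n; have [q qP] := bFCM G i p.
have [m mP] : exists m, (1 < (e / 2) *+ m)%R by apply: mulrn_gt1.
exists (maxn q m) => y ey.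
have := integral_ge mu_prob (ltW e0) (fun x => commg_mean01 i [~ y, x]) ey.
set B : set G := [set x | _] => eB.
have [s sm cov] := content_cover mu_prob mu_inv eB mP.
pose C : set G := [set g | bFC i p [~ g, y]].
have BC b c : B b -> B c -> C (b^-1 * c).
  move=> /nP fb /nP fc; apply: bFC_commgC.
  have -> : [~ y, b^-1 * c] = [~ y, c] * ([~ y, b]^-1) ^ (b^-1 * c).
    by rewrite /commg /conjg !gnorm.
  by apply: pP => //; apply: bFCJ; apply: bFCV.
have CC a b : C a -> C b -> bFC i q [~ a / b, y].
  move=> Ca Cb; rewrite commgFl; apply: bFCJ; apply: qP => //; exact: bFCV.
suff : index_le setT [set g | bFC i q [~ g, y]] (size s).
  apply: index_leW => // [g|]; first by apply: bFC_mono; apply: leq_maxl.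
  exact: leq_trans sm (leq_maxr _ _).
apply: (index_le_cover _ CC) => g _; have [t ts [b [c [Bb Bc e']]]] := cov g.
by exists t => //; rewrite e'; apply: BC.
Qed.

(** The outermost integral runs over the first entry y of the commutator, and its
integrand is the iterated mean in the other entries. *)
Lemma bFC_content_gt0 k :
    (0 < iter_integral mu
        (fun t : k.+1.-tuple G => (\1_(@left_normed_fiber G k.+1) t)%:E))%E ->
  exists n (d : R), (0 < d)%R /\ (d%:E <= mu (@bFC G k n))%E.
Proof.
have -> : iter_integral mu
    (fun t : k.+1.-tuple G => (\1_(@left_normed_fiber G k.+1) t)%:E)%E =
    (\int[mu]_x commg_mean k x)%E.
  by rewrite /=; congr integral; apply/funext => x; rewrite -iter_integral_commg_mean.
set I := (\int[mu]_x _)%E => I0.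
have I1 : (I <= 1)%E.
  by case/andP: (integral01 mu_prob (commg_mean01 k)).
have [e eE] : exists e, I = e%:E.
  by exists (fine I); rewrite fineK// ge0_fin_numE ?ltW// (le_lt_trans I1) ?ltry.
have e0 : (0 < e)%R by rewrite -lte_fin -eE.
have e20 : (0 < e / 2)%R by rewrite divr_gt0.
have [n nP] := commg_mean_bFC k e20; exists n, (e / 2)%R; split=> //.
have := integral_ge mu_prob (ltW e0) (commg_mean01 k); rewrite -eE lexx => /(_ isT).
by move/le_trans; apply; apply: content_le => x /= /nP.
Qed.

Lemma content_cover_gt0 (B : set G) (d : R) : (0 < d)%R -> (d%:E <= mu B)%E ->
  exists s : seq G, forall g, exists2 t, t \in s &
    exists b c, [/\ B b, B c & g / t = b^-1 * c].
Proof.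
move=> d0 dB.
have [m mP] : exists m, (1 < d *+ m)%R by apply: mulrn_gt1.
by have [s _ cov] := content_cover mu_prob mu_inv dB mP; exists s.
Qed.

(** The union H of the bFC k n is covered by finitely many translates by elements
t of a single bFC k p.  Those t that occur for elements of H are themselves in
H, so in one bFC k q, whence H is contained in one bFC k m. *)
Lemma bFC_fin_index k :
    (0 < iter_integral mu
        (fun t : k.+1.-tuple G => (\1_(@left_normed_fiber G k.+1) t)%:E))%E ->
  exists m, subgroup (@bFC G k m) /\ fin_index setT (@bFC G k m).
Proof.
move=> /bFC_content_gt0[n [d [d0 dF]]].
have [s cov] := content_cover_gt0 d0 dF.
have [p pP] := bFCM G k n.
pose H : set G := [set x | exists q, @bFC G k q x].
have {}cov g : exists2 t, t \in s & @bFC G k p (g / t).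
  have [t ts [b [c [fb fc e]]]] := cov g; exists t; rewrite ?e//.
  by apply: pP => //; apply: bFCV.
have sH : subgroup H.
  split; first by exists 1%N; apply: bFC1.
  move=> x y [q fx] [r fy]; have [u uP] := bFCM G k (maxn q r); exists u.
  apply: uP; first by apply: bFC_mono fx; apply: leq_maxl.
  by apply: bFCV; apply: bFC_mono fy; apply: leq_maxr.
have [q qP] : exists q, forall t, t \in s -> H t -> @bFC G k q t.
  elim: (s) => [|t r [q qP]]; first by exists 0%N.
  have [[q' tq']|nHt] := pselect (H t).
    exists (maxn q q') => u; rewrite inE => /orP[/eqP-> _|ur Hu].
      by apply: bFC_mono tq'; apply: leq_maxr.
    by apply: bFC_mono (qP u ur Hu); apply: leq_maxl.
  exists q => u; rewrite inE => /orP[/eqP->//|]; exact: qP.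
have [m mP] := bFCM G k (maxn p q).
have HE : H = @bFC G k m.
  apply/seteqP; split=> [g Hg|g]; last by exists m.
  have [t ts fgt] := cov g.
  have Ht : H t.
    rewrite -(invgK t) -[t^-1](mulKg g) invgM; apply: (subgroupM sH).
      by apply: (subgroupV sH); exists p.
    by rewrite invgK.
  rewrite -(mulgVK t g); apply: mP.
    by apply: bFC_mono fgt; apply: leq_maxl.
  by apply: bFC_mono (qP t ts Ht); apply: leq_maxr.
exists m; rewrite -HE; split=> //; apply/fin_index_coverP => //.
exists s => g _; have [t ts fgt] := cov g; exists t => //; by exists p.
Qed.

End Iter.

(** * Ultrapowers and uniform local finiteness *)

(** The ultrapower of G / N is never formed: statements about it are made in the
group of sequences in G, modulo the sequences that are in N almost everywhere. *)
Definition sequences (G : groupType) : Type := nat -> G.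

Section SequenceGroup.
Variable G : groupType.
Local Notation P := (sequences G).

HB.instance Definition _ := gen_eqMixin P.
HB.instance Definition _ := gen_choiceMixin P.

Let one : P := fun=> 1.
Let inv (x : P) : P := fun r => (x r)^-1.
Let mul (x y : P) : P := fun r => x r * y r.

Let mulA : associative mul.
Proof. by move=> x y z; apply/funext => r; apply: mulgA. Qed.
Let mul1x : left_id one mul.
Proof. by move=> x; apply/funext => r; apply: mul1g. Qed.
Let mulx1 : right_id one mul.
Proof. by move=> x; apply/funext => r; apply: mulg1. Qed.
Let mulVx : left_inverse one inv mul.
Proof. by move=> x; apply/funext => r; apply: mulVg. Qed.
Let mulxV : right_inverse one inv mul.
Proof. by move=> x; apply/funext => r; apply: mulgV. Qed.

HB.instance Definition _ := isGroup.Build P mulA mul1x mulx1 mulVx mulxV.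

Lemma seqX (x : P) n r : (x ^+ n) r = x r ^+ n.
Proof. by elim: n => // n IHn; rewrite !expgS -IHn. Qed.

End SequenceGroup.

Section Ultra.
Variables (G : groupType) (U : set_system nat).
Hypothesis UU : UltraFilter U.
Local Notation P := (sequences G).

Definition almost (A : nat -> set G) : set P := [set x | U [set r | A r (x r)]].

Lemma ultra_bounded (n : nat) (f : nat -> nat) :
  U [set r | (f r < n)%N] -> exists2 a, (a < n)%N & U [set r | f r = a].
Proof.
elim: n => [|n IHn] Uf.
  by have [r] := filter_ex Uf.
have [Ua|Ua] := in_ultra_setVsetC [set r | f r = n] UU; first by exists n.
have [|a an Uan] := IHn; last by exists a => //; apply: ltnW.
apply: filterS (filterI Uf Ua) => r [/= fn /eqP nfn].
by rewrite ltn_neqAle nfn -ltnS.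
Qed.

(** The colour of a sequence is the one that its entries have almost everywhere;
it exists since n bounds the number of colours at almost all indices. *)
Lemma almost_index_le (A : nat -> set G) n :
  U [set r | index_le setT (A r) n] -> index_le setT (almost A) n.
Proof.
move=> UA.
have /choice[c cP] : forall r, exists c : G -> nat, index_le setT (A r) n ->
    (forall g, (c g < n)%N) /\ (forall g h, c g = c h -> A r (g / h)).
  move=> r; have [[c [cn cA]]|nA] := pselect (index_le setT (A r) n).
    by exists c => _; split=> [g|g h]; [apply: cn|apply: cA].
  by exists (fun=> 0%N).
have /choice[d dP] : forall x : P, exists a, (a < n)%N /\ U [set r | c r (x r) = a].
  move=> x; have [|a an Ua] := @ultra_bounded n (fun r => c r (x r)).
    by apply: filterS UA => r /cP[cn _]; apply: cn.
  by exists a.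
exists d; split=> [x _|x y _ _ dxy]; first by case: (dP x).
have [_ Ux] := dP x; have [_ Uy] := dP y.
apply: filterS (filterI UA (filterI Ux Uy)) => r [/cP[_ cA] [/= cx cy]].
by apply: cA; rewrite cx cy.
Qed.

Variable N : normal_subgroup G.
Let M := almost (fun=> N).

Lemma almost_normal : normal_in setT M.
Proof.
have sN := nsub_subgroup N.
split=> //; last first.
  by move=> x h Mx _; apply: filterS Mx => r /= Nx; exact: nsub_conjg.
split; first by apply: filterS filterT => r _; exact: subgroup1.
move=> x y Mx My; apply: filterS (filterI Mx My) => r [/= Nx Ny].
exact: subgroupF.
Qed.

(** Here the uniformity of bFC in n is essential: entries in FC_i(G) without a
common bound need not give an element of the i-th layer over M. *)
Lemma almost_bFC i n (x : P) : almost (fun=> bFC i n) x -> iter i (FC_mod setT) M x.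
Proof.
elim: i x => [|i IHi] x xF.
  by apply: filterS xF => r /= ->; apply: subgroup1; exact: nsub_subgroup.
apply/FC_modP => //; first by apply: iter_FC_mod_normal => //; exact: almost_normal.
split=> //; exists n.
have := @almost_index_le (fun r => [set g | bFC i n [~ g, x r]]) n xF.
by apply: index_leW => // g gF; apply: IHi.
Qed.

Lemma filter_all_in (I : eqType) (s : seq I) (B : I -> set nat) :
  (forall i, i \in s -> U (B i)) -> U [set r | forall i, i \in s -> B i r].
Proof.
elim: s => [|i s IHs] UB; first by apply: filterS filterT.
have Us : U [set r | forall i, i \in s -> B i r].
  by apply: IHs => j js; apply: UB; rewrite inE js orbT.
have Ui : U (B i) by apply: UB; rewrite inE eqxx.
apply: filterS (filterI Ui Us) => r [Bi Bs] j.
by rewrite inE => /orP[/eqP->//|]; apply: Bs.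
Qed.

End Ultra.

Lemma card_le_seq (T S : choiceType) (s : seq T) (f : T -> S) (A : set S) :
  (forall x, A x -> exists2 t, t \in s & x = f t) -> (A #<= `I_(size s))%card.
Proof.
case: s => [|t0 s] As.
  have -> : A = set0 by apply/seteqP; split=> // x /As[].
  exact: card_ge0.
pose F j := f (nth t0 (t0 :: s) j).
apply: (@card_le_trans _ _ _ (F @` `I_(size (t0 :: s)))).
  apply: subset_card_le => x /As[t ts ->]; exists (index t (t0 :: s)).
    by rewrite -index_mem in ts.
  by rewrite /F nth_index.
exact: card_image_le.
Qed.

(** For each r, let x r be a tuple generating a subgroup of G / N with more than r
elements, if d admits no bound.  The sequences y of representatives generate a
group L in which M has finite index, with representatives s.  The relations
stating that multiplication by y a or its inverse sends cosets of elements of s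
to such cosets hold at almost all indices r, in particular at some r >= size s;
there the subgroup generated by x r is contained in the image of s. *)
Lemma quotient_ulf (G : groupType) (N : normal_subgroup G) k m e :
    (0 < e)%N -> (forall g, nsub N (g ^+ e)) -> fin_index setT (@bFC G k m) ->
  uniformly_locally_finite (quotient_group N).
Proof.
move=> e0 Ne [n0 fi] d _; apply: contrapT => nbd.
have /choice[x xP] : forall r, exists x : 'I_d -> quotient_group N,
    ~ (generated (range x) #<= `I_r)%card.
  by move=> r; apply/existsNP => rP; apply: nbd; exists r.
pose y a : sequences G := fun r => repr (x r a).
have yE r a : quo N (y a r) = x r a by apply: quo_repr.
(* U extends the cofinite filter, so that it has arbitrarily large indices *)
have [U [UU ooU]] := ultraFilterLemma (eventually_filter).
pose M := almost U (fun=> N : set G).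
have nM : normal_in setT M by apply: almost_normal.
have [sM _ nMJ] := nM.
pose ys := [seq y a | a <- enum 'I_d].
pose L := generated [set` ys].
have sL : subgroup L by apply: subgroup_generated.
have Ly a : L (y a).
  by apply: sub_generated => /=; apply: map_f; rewrite mem_enum.
have fiL : fin_index L M.
  apply: (@fin_index_FC_torsion _ M e k) => //.
  - by move=> z; apply: filterS filterT => r _ /=; rewrite seqX.
  - by exists ys.
  exists n0; have := @almost_index_le G U UU (fun=> bFC k m) n0.
  move=> /(_ (filterS (fun _ _ => fi) filterT)); apply: index_leW => // z.
  exact: almost_bFC.
have [n /index_le_repr[s sLs cov]] := fiL.
(* z is congruent to an element of s modulo N at the index r *)
pose near (z : sequences G) r := exists2 t, t \in s & nsub N (z r / t r).
have nearU z : L z -> U (near z).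
  move=> /cov[t ts Mz]; apply: filterS Mz => r /= Nz; by exists t.
have U1 : U (near 1) by apply: nearU; apply: subgroup1.
have Us : U [set r | forall t, t \in s -> forall a, a \in enum 'I_d ->
    (near (t * y a) `&` near (t / y a)) r].
  apply: filter_all_in => t ts; apply: filter_all_in => a _.
  have Lt := sLs t ts.
  apply: filterI; apply: nearU; first exact: (subgroupM sL).
  exact: (subgroupF sL).
have Ur : U [set r | (size s <= r)%N] by apply: ooU; exists (size s).
have [r [[t1 t1s Nt1] [rs sr]]] := filter_ex (filterI U1 (filterI Us Ur)).
apply: (xP r); apply: (@card_le_trans _ _ _ `I_(size s)); last by rewrite card_le_II.
have quoE a b : nsub N (a / b) -> quo N a = quo N b.
  move=> /(nsub_V) Nab; apply/quo_eqP.
  by have := nsub_conjg a Nab; rewrite /conjg !gnorm.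
apply: (@card_le_seq _ _ s (fun t => quo N (t r))).
apply: generated_ind; first by exists t1 => //; rewrite -(quoE _ _ Nt1).
move=> _ _ [t ts ->] [a _ <-].
have ia : a \in enum 'I_d by rewrite mem_enum.
have [[t2 t2s /quoE e2] [t3 t3s /quoE e3]] := rs t ts a ia.
split.
  by exists t2 => //; rewrite -e2 -yE -gmulfM.
exists t3 => //; rewrite -e3 -yE.
have -> : (quo N (y a r))^-1 = quo N (y a r)^-1 by exact: quo_invE.
by rewrite -gmulfM.
Qed.

Theorem theorem2 (R : realType) (k : nat) (G : groupType)
    (mu : {content set (discr G) -> \bar R}%R)
    (hk : (1 <= k)%N)
    (mu_prob : mu [set: discr G] = 1%E)
    (mu_inv : right_invariant mu)
    (mu_pos : (0 < iter_integral mu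
        (fun t : k.-tuple G => (\1_(@left_normed_fiber G k) t)%:E))%E) :
  (exists H : set G,
      [/\ subgroup H, finite_index [set: G] H & FC_nilpotent H k.-1]) /\
  (exists N : normal_subgroup G,
      [/\ characteristic N,
          (exists c : nat, (c < k)%N /\ nilpotent_class_le N c)
        & uniformly_locally_finite (quotient_group N)]).
Proof.
case: k hk mu_pos => // k _ mu_pos /=.
have [m [sH fiH]] := bFC_fin_index mu_prob mu_inv mu_pos.
split.
  exists (@bFC G k m); split=> //; first exact/finite_indexP.
  split=> //; apply/seteqP; split=> [x Hx|].
    by apply: (@bFC_sub_FC G (bFC k m) k m).
  by rewrite FC_iter; case: (iter_FC_mod_normal k sH (normal_in1 sH)).
have [d d0 dP] := @bFC_iter_cent G k m.
have [n fin] := fiH; pose e := (d * n`!)%N.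
have e0 : (0 < e)%N by rewrite muln_gt0 d0 fact_gt0.
have [sN _ nN] := power_subgroup_normal G e.
pose N := NormalSubgroup sN (fun x y Nx => nN x y Nx I).
have NH : power_subgroup e `<=` @bFC G k m.
  apply: power_subgroup_min => // g; rewrite /e mulnC expgnA.
  apply: (subgroupX sH).
  have [j /andP[j0 jn] Hj] := index_le_expg g fin.
  have /dvdnP[q ->] : (j %| n`!)%N by rewrite dvdn_fact// j0.
  by rewrite mulnC expgnA; apply: (subgroupX sH).
exists N; split.
- exact: power_subgroup_characteristic.
- exists k; split=> //; apply: nilpotent_iter_cent; first exact: power_subgroup_normal.
  by move=> x /NH/dP; apply: iter_cent_anti; apply: power_subgroup_dvd.
- by apply: (quotient_ulf (e := e) (k := k) (m := m)) => // g; apply: power_subgroup_expg.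
Qed.
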